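(* For almost every linear map $\mathcal{A}:\mathbb{R}^{S^K}\to\mathbb{R}^{m\times n}$ such that $$\mathrm{rk}(\mathcal{A})\geq\dim J\left(P(\mathcal{M}^L),P(\mathcal{M}^{L'})\right)\quad\text{for all } L,L'\in\mathbb{N},$$ $\mathcal{M}$ is identifiable.
   Context: $K\geq 1$, $S\geq 2$, $m,n\geq1$ are integers, $[K]=\{1,\dots,K\}$, $[S]=\{1,\dots,S\}$. An element $\mathbf{h}\in\mathbb{R}^{S\times K}$ is a $K$-tuple of vectors $\mathbf{h}_1,\dots,\mathbf{h}_K\in\mathbb{R}^S$ with entries $\mathbf{h}_{k,i}$. $\mathbb{R}^{S^K}$ is the space of real order-$K$ tensors. $P:\mathbb{R}^{S\times K}\to\mathbb{R}^{S^K}$, $P(\mathbf{h})_{\mathbf{i}}=\mathbf{h}_{1,i_1}\cdots\mathbf{h}_{K,i_K}$ for $\mathbf{i}\in[S]^K$. $\mathcal{M}=(\mathcal{M}^L)_{L\in\mathbb{N}}$ is a collection of models: each $\mathcal{M}^L$ is a nonempty subset of $\mathbb{R}^{S\times K}$. Join: for $Y,Z\subset\mathbb{R}^{S^K}$, $J(Y,Z)=\overline{\{sy+tz : y\in Y,\ z\in Z,\ s,t\in\mathbb{R}\}}$, where the bar is the Zariski closure, and $\dim$ is the dimension as a real algebraic variety. ''Almost every $\mathcal{A}$'' means: for each fixed rank $r$ such that $r\geq\dim J(P(\mathcal{M}^L),P(\mathcal{M}^{L'}))$ for all $L,L'$, when $\mathcal{A}$ has rank $r$ and $\mathrm{Ker}(\mathcal{A})$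 varies as a point of the Grassmannian of $(S^K-r)$-dimensional linear subspaces of $\mathbb{R}^{S^K}$, the conclusion holds for all kernels outside a set of measure zero in that Grassmannian. $\mathbb{R}^{S\times K}_*=\{\mathbf{h} : \mathbf{h}_k\neq0\ \forall k\in[K]\}$; on it, $\mathbf{h}\sim\mathbf{g}$ iff there are $\lambda_1,\dots,\lambda_K\in\mathbb{R}$ with $\prod_k\lambda_k=1$ and $\mathbf{h}_k=\lambda_k\mathbf{g}_k$ for all $k$; $\langle\mathbf{h}\rangle$ is the class of $\mathbf{h}$. For $\overline{\mathbf{h}}\in\mathcal{M}^{\overline L}\cap\mathbb{R}^{S\times K}_*$, put $X=\mathcal{A}P(\overline{\mathbf{h}})$; $\langle\overline{\mathbf{h}}\rangle$ is identifiable (with respect to $\mathcal{A}$) if every minimizer of $\|\mathcal{A}P(\mathbf{h})-X\|^2$ over $L\in\mathbb{N}$, $\mathbf{h}\in\mathcal{M}^L$ belongs to $\langle\overline{\mathbf{h}}\rangle$. $\mathcal{M}$ is identifiable if for every $L\in\mathbb{N}$ and every $\overline{\mathbf{h}}\in\mathcal{M}^L\cap\mathbb{R}^{S\times K}_*$, $\langle\overline{\mathbf{h}}\rangle$ is identifiable. *)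

(* Defs.v *)
From HB Require Import structures.
From mathcomp Require Import all_boot all_order all_algebra.
From mathcomp Require Import all_classical all_reals all_analysis.
From mathcomp Require mpoly.
(* The notations of multinomials clash with those of mathcomp-analysis. *)
Import -(notations) mpoly.

Set Implicit Arguments.
Unset Strict Implicit.
Unset Printing Implicit Defensive.

Import Order.TTheory GRing.Theory Num.Theory.

Local Open Scope classical_set_scope.
Local Open Scope ring_scope.

Section LebesgueNull.
Variables (R : realType) (D : finType).

Definition box (a b : D -> R) : set (D -> R) :=
  [set x | forall i, a i <= x i <= b i].

Definition box_vol (a b : D -> R) : R := \prod_i Num.max 0 (b i - a i).

(* Lebesgue null sets of R^D. The covering family is indexed by an arbitrary
   set of naturals, so that it may be finite or empty: if D is empty, R^D is a
   point, its only box has volume 1, and only the empty set is null. *)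
Definition lebesgue_null (E : set (D -> R)) :=
  forall e : R, 0 < e ->
  exists (Q : set nat) (a b : nat -> D -> R),
    E `<=` \bigcup_(k in Q) box (a k) (b k) /\
    (\esum_(k in Q) (box_vol (a k) (b k))%:E <= e%:E)%E.

End LebesgueNull.

Section ZariskiTopology.
Variables (R : realType) (I : finType).
Local Notation space := {ffun I -> R^o}.

Definition coord_eval (p : mpoly #|I| R) (x : space) : R :=
  meval (fun j => x (enum_val j)) p.

Definition zariski_closed (Z : set space) :=
  exists F : set (mpoly #|I| R), Z = [set x | forall p, F p -> coord_eval p x = 0].

Definition zariski_closure (Y : set space) : set space :=
  smallest zariski_closed Y.

Definition irreducible (Z : set space) :=
  Z !=set0 /\
  forall Z1 Z2, zariski_closed Z1 -> zariski_closed Z2 ->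
    Z `<=` Z1 `|` Z2 -> Z `<=` Z1 \/ Z `<=` Z2.

Definition irreducible_chain (X : set space) (d : nat) :=
  exists Z : nat -> set space,
    (forall i, (i <= d)%N ->
       [/\ zariski_closed (Z i), irreducible (Z i) & Z i `<=` X]) /\
    (forall i, (i < d)%N -> Z i `<` Z i.+1).

(* Krull dimension of the Zariski-closed set X; it is -oo for X = set0. *)
Definition zariski_dim (X : set space) : \bar R :=
  ereal_sup [set (d%:R)%:E | d in irreducible_chain X].

Definition join_variety (Y Z : set space) : set space :=
  zariski_closure
    [set x | exists y z (s t : R), [/\ Y y, Z z & x = s *: y + t *: z]].

End ZariskiTopology.

Section Grassmannian.
Variables (R : realType) (I : finType).
Local Notation space := {ffun I -> R^o}.

Definition grassmannian (d : nat) : set {vspace space} :=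
  [set V | \dim V = d].

Definition basis_vec (i : I) : space := [ffun i' => (i' == i)%:R].

(* Standard chart of the Grassmannian attached to a coordinate subset J: the
   matrix X of a linear map R^J -> R^(~: J) is sent to the graph of this map. *)
Definition chart_idx (J : {set I}) : finType :=
  ({j : I | j \in J} * {i : I | i \notin J})%type.

Definition chart_vec (J : {set I}) (X : chart_idx J -> R) (j : {j : I | j \in J})
  : space :=
  basis_vec (val j) +
  \sum_(i : {i : I | i \notin J}) X (j, i) *: basis_vec (val i).

Definition chart (J : {set I}) (X : chart_idx J -> R) : {vspace space} :=
  << [seq chart_vec X j | j : {j : I | j \in J}] >>%VS.

(* A subset of a manifold has measure zero when it is Lebesgue null in all the
   charts of a (finite) atlas; the charts with #|J| = d cover grassmannian d. *)
Definition grassmann_null (d : nat) (E : set {vspace space}) :=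
  E `<=` grassmannian d /\
  forall J : {set I}, #|J| = d -> lebesgue_null (@chart J @^-1` E).

End Grassmannian.

Section Identifiability.
Variables (R : realType) (K S m n : nat).

Definition tensor_idx : finType := {ffun 'I_K -> 'I_S}.
Local Notation tensor := {ffun tensor_idx -> R^o}.

(* h : 'M_(S, K) has columns h_1, ..., h_K, i.e. h i k is the entry h_(k,i). *)
Definition tensor_prod (h : 'M[R]_(S, K)) : tensor :=
  [ffun i : tensor_idx => \prod_(k < K) h (i k) k].

Definition params_star : set 'M[R]_(S, K) :=
  [set h | forall k, col k h != 0].

Definition scale_equiv (h g : 'M[R]_(S, K)) :=
  exists lam : 'I_K -> R,
    \prod_k lam k = 1 /\ forall k, col k h = lam k *: col k g.

Definition scale_class (g : 'M[R]_(S, K)) : set 'M[R]_(S, K) :=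
  [set h | params_star h /\ scale_equiv h g].

(* Squared Euclidean (Frobenius) norm; the norm of mathcomp-analysis on
   matrices is the sup norm. *)
Definition sqnorm (X : 'M[R]_(m, n)) : R := \sum_i \sum_j X i j ^+ 2.

Variables (A : 'Hom(tensor, 'M[R]_(m, n)))
          (M : nat -> set 'M[R]_(S, K)).

Definition minimizer (X : 'M[R]_(m, n)) (L : nat) (h : 'M[R]_(S, K)) :=
  M L h /\
  forall L' g, M L' g ->
    sqnorm (A (tensor_prod h) - X) <= sqnorm (A (tensor_prod g) - X).

Definition identifiable_class (hbar : 'M[R]_(S, K)) :=
  forall L h, minimizer (A (tensor_prod hbar)) L h -> scale_class hbar h.

Definition identifiable_model :=
  forall L hbar, M L hbar -> params_star hbar -> identifiable_class hbar.

End Identifiability.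

(* Main.v *)
Require Import Defs.
From mathcomp Require Import all_boot all_order all_algebra.
From mathcomp Require Import all_classical all_reals all_analysis.
From mathcomp Require Import ring lra.
From mathcomp Require mpoly.
Import -(notations) mpoly.

(* If [A P(h) = A P(hbar)] and [P(h) <> P(hbar)], then [P(h) - P(hbar)] is a
   nonzero vector of [Ker A] in one of the countably many joins, and each join is
   a Zariski-closed cone [C] of dimension at most [r]. So it suffices that almost
   every subspace of codimension [r] meets such a cone only in 0.
     In a chart, a nonzero vector of [C] in the graph of [X] can be scaled to a
   point [x] of [C] with [x j0 = 1]. Once the rows of [X] other than [j0] are
   fixed, the row [j0] is the image of [x] under an affine map from
   [C /\ x j0 = 1] to R^r. If the bad set were not null, then by Fubini one of
   these images would not be null either. But a Zariski-closed set whose image in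
   R^k under a polynomial map is not null has a chain of irreducible closed
   subsets of length [k]: take a closed subset minimal with non-null image
   (Hilbert's basis theorem), which is irreducible, slice it by a hyperplane of
   R^k with Fubini, and induct. Adding the cone over the top of the chain gives
   a chain of length [r + 1] in [C], a contradiction. *)

Set Implicit Arguments.
Unset Strict Implicit.
Unset Printing Implicit Defensive.

Import Order.TTheory GRing.Theory Num.Theory.
Import numFieldNormedType.Exports.

Local Open Scope classical_set_scope.
Local Open Scope ring_scope.

(** * Null images: finite covers by boxes in selected coordinates *)

Section FiniteCovers.
Variables (R : realType) (D : finType).
Implicit Types (T : {set D}) (q : (D -> R) * (D -> R)).

(** The empty product is 1, so for empty [T] only the empty set is null. *)
Definition part_vol T q : R := \prod_(t in T) Num.max 0 (q.2 t - q.1 t).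

Definition in_part T q (x : D -> R) := [forall t in T, q.1 t < x t < q.2 t].

(* The image of [A] under [(f t)_(t in T)] is covered by finitely many open boxes
   of R^T of total volume at most [e]; finitely many suffice, as only compact
   images occur. Selecting coordinates by [T] keeps all boxes in one type, and
   slices of a set are again sets of the same type. *)
Definition finite_cover (Y : Type) (f : D -> Y -> R) T (A : set Y) (e : R) :=
  exists s : seq ((D -> R) * (D -> R)),
    (forall y, A y -> has (in_part T ^~ (f ^~ y)) s) /\
    \sum_(q <- s) part_vol T q <= e.

Definition finite_null (Y : Type) (f : D -> Y -> R) T (A : set Y) :=
  forall e, 0 < e -> finite_cover f T A e.

Lemma part_vol_ge0 T q : 0 <= part_vol T q.
Proof. by apply: prodr_ge0 => t _; rewrite le_max lexx. Qed.

Section CoverTheory.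
Variables (Y : Type) (f : D -> Y -> R).
Implicit Types (A B : set Y) (e : R).

Lemma finite_coverS T A B e e' :
  A `<=` B -> e <= e' -> finite_cover f T B e -> finite_cover f T A e'.
Proof.
move=> AB ee' [s [sB se]]; exists s; split; last exact: le_trans se ee'.
by move=> y /AB /sB.
Qed.

Lemma finite_coverU T A B e e' : finite_cover f T A e ->
  finite_cover f T B e' -> finite_cover f T (A `|` B) (e + e').
Proof.
move=> [s [sA se]] [s' [sB se']]; exists (s ++ s'); split.
  by move=> y; rewrite has_cat => -[/sA ->//|/sB ->]; rewrite orbT.
by rewrite big_cat lerD.
Qed.

Lemma finite_cover0 T : finite_cover f T set0 0.
Proof. by exists [::]; split => //; rewrite big_nil. Qed.

Lemma finite_nullS T A B : A `<=` B -> finite_null f T B -> finite_null f T A.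
Proof. by move=> AB nB e /nB; exact: finite_coverS. Qed.

Lemma finite_nullU T A B :
  finite_null f T A -> finite_null f T B -> finite_null f T (A `|` B).
Proof.
move=> nA nB e e0; rewrite [e]splitr.
by apply: finite_coverU; [apply: nA|apply: nB]; rewrite divr_gt0.
Qed.

Lemma finite_null_set0 T : finite_null f T set0.
Proof.
by move=> e /ltW e0; apply: finite_coverS (finite_cover0 T).
Qed.

(** Each box is thickened by the interval from [u] to [v] in coordinate [t0], which multiplies its
    volume by [v - u]. *)
Lemma finite_cover_slab T t0 A e (u v : R) : t0 \in T -> u <= v ->
  (forall y, A y -> u < f t0 y < v) ->
  finite_cover f (T :\ t0) A e -> finite_cover f T A ((v - u) * e).
Proof.
move=> t0T uv Auv [s [sA se]].
pose g q : (D -> R) * (D -> R) :=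
  (fun t => if t == t0 then u else q.1 t, fun t => if t == t0 then v else q.2 t).
exists [seq g q | q <- s]; split.
  move=> y Ay; rewrite has_map; apply: sub_has (sA _ Ay) => q /= /'forall_implyP qy.
  apply/'forall_implyP => t tT /=; case: eqP => [->|/eqP tt0]; first exact: Auv.
  by apply: qy; rewrite !inE tt0.
rewrite big_map (eq_bigr (fun q => (v - u) * part_vol (T :\ t0) q)).
  by rewrite -mulr_sumr ler_wpM2l // subr_ge0.
move=> q _; rewrite /part_vol (big_setD1 t0) //= eqxx; congr (_ * _).
  by apply/max_idPr; rewrite subr_ge0.
by apply: eq_bigr => t; rewrite !inE => /andP[/negbTE -> _].
Qed.

Lemma finite_cover_bounded T A (b : D -> R) :
  (forall t y, A y -> - b t < f t y < b t) -> exists e, finite_cover f T A e.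
Proof.
move=> Ab; exists (\sum_(q <- [:: (fun t => - b t, b)]) part_vol T q).
exists [:: (fun t => - b t, b)]; split => // y Ay /=.
by rewrite orbF; apply/'forall_implyP => t _; exact: Ab.
Qed.

(* Fixing a coordinate in [T] makes the box arbitrarily thin in it. *)
Lemma finite_null_hyperplane T t0 A (b : D -> R) c : t0 \in T ->
  (forall t y, A y -> - b t < f t y < b t) ->
  (forall y, A y -> f t0 y = c) -> finite_null f T A.
Proof.
move=> t0T Ab Ac e e0; have [e1 Ae1] := finite_cover_bounded (T :\ t0) Ab.
have e1ge0 : 0 <= e1.
  by case: Ae1 => s [_]; apply: le_trans; apply: sumr_ge0 => q _; exact: part_vol_ge0.
(* The slab has width [2 * d = e / (e1 + 1)], so its cover has volume at most [e]; the 1 guards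
   against [e1 = 0]. *)
pose d := e / (e1 + 1) / 2.
have d0 : 0 < d by rewrite !divr_gt0 // ltr_wpDl.
apply: finite_coverS (_ : _ `<=` _) _ (finite_cover_slab (u := c - d) (v := c + d) t0T _ _ Ae1) => //.
- have -> : (c + d - (c - d)) * e1 = e * (e1 / (e1 + 1)).
    by rewrite /d; field; rewrite gt_eqF // ltr_wpDl.
  by rewrite ger_pMr // ler_pdivrMr ?ltr_wpDl // mul1r lerDl.
- by lra.
- by move=> y /Ac ->; apply/andP; split; lra.
Qed.

End CoverTheory.

(** Only the values of the coordinates in [T] enter a cover, so covers can be moved between
    different domains. *)
Lemma finite_cover_transfer (Y Y' : Type) (f : D -> Y -> R) (f' : D -> Y' -> R)
    T (A : set Y) (A' : set Y') e :
  (forall y, A y -> exists2 y', A' y' & forall t, t \in T -> f t y = f' t y') ->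
  finite_cover f' T A' e -> finite_cover f T A e.
Proof.
move=> AA' [s [sA se]]; exists s; split => // y /AA' [y' /sA sy' ff'].
apply: sub_has sy' => q /'forall_implyP qy'; apply/'forall_implyP => t tT.
by rewrite ff' //; exact: qy'.
Qed.

(** * Fubini for compact sets with continuous coordinates *)

Section Fubini.
Variables (Y : topologicalType) (f : D -> Y -> R).
Hypothesis fc : forall t, continuous (f t).

(** The boxes of a cover are open, so they still cover nearby points. *)
Lemma finite_cover_nbhs T (A : set Y) e : finite_cover f T A e ->
  exists U, (forall y, A y -> nbhs y U) /\ finite_cover f T U e.
Proof.
move=> [s [sA se]]; exists [set y | has (in_part T ^~ (f ^~ y)) s].
split; last by exists s.
move=> y /sA {sA se}; elim: s => //= q s IH /orP[/'forall_implyP qy|/IH sy].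
- suff : \forall z \near y, forall t, t \in T -> q.1 t < f t z < q.2 t.
    by apply: filterS => z qz /=; apply/orP; left; apply/'forall_implyP.
  apply: filter_forall => t; have [tT|_] := boolP (t \in T); last exact: nearW.
  have /andP[q1 q2] := qy _ tT; near=> z => _; apply/andP; split; near: z.
  + by apply: (cvgr_gt (f t y)) => //; exact: fc.
  + by apply: (cvgr_lt (f t y)) => //; exact: fc.
- by apply: filterS sy => z /= ->; rewrite orbT.
Unshelve. all: by end_near. Qed.

Lemma compact_coords_bounded (K : set Y) : compact K ->
  exists b : D -> R, forall t y, K y -> - b t < f t y < b t.
Proof.
move=> cK; suff /choice[b Kb] : forall t, exists b, forall y, K y -> - b < f t y < b.
  by exists b.
move=> t; have /compact_bounded[M [_ MK]] : compact (f t @` K).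
  by apply: continuous_compact => //; exact: continuous_subspaceT.
exists (`|M| + 2) => y Ky; rewrite -ltr_norml.
apply: (@le_lt_trans _ _ (`|M| + 1)); last by rewrite ltrD2l ltr1n.
by apply: MK; [rewrite (le_lt_trans (ler_norm _)) // ltrDl | exists y].
Qed.

(** Tube lemma: by compactness of [K], the levels of [g] close to [c] stay in [U]. *)
Lemma near_slices (K : set Y) (g : Y -> R) c (U : set Y) :
  compact K -> continuous g -> (forall y, K y -> g y = c -> nbhs y U) ->
  exists2 d, 0 < d & forall y, K y -> `|c - g y| < d -> U y.
Proof.
move=> /compact_near_coveringP cK gc KU.
have : \forall c' \near nbhs c, K `<=` [set y | g y = c' -> U y].
  apply: (cK _ _ (fun c' y => g y = c' -> U y)) => y Ky.
  have [gy|/eqP gy] := pselect (g y = c).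
    near=> z c' => /= _; near: z; exact: KU.
  (* Off the level [c], a point [z] near [y] and a value [c'] near [c] never satisfy [g z = c']. *)
  have d0 : 0 < `|g y - c| / 2 by rewrite divr_gt0 // normr_gt0 subr_eq0.
  near=> z c' => /= E; exfalso.
  have h1 : `|g y - g z| < `|g y - c| / 2.
    by near: z; apply: (cvgr_dist_lt g (g y)) => //; exact: gc.
  have h2 : `|c - c'| < `|g y - c| / 2.
    by near: c'; apply: (cvgr_dist_lt id c) => //; exact: cvg_id.
  have : `|g y - c| <= `|g y - g z| + `|c - c'|.
    by rewrite E [`|c - c'|]distrC (le_trans _ (ler_normD _ _)) // addrA subrK.
  by lra.
move=> /nbhs_ballP[d d0 dU]; exists d => // y Ky yd; exact: (dU (g y)).
Unshelve. all: by end_near. Qed.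

(** By compactness one slab width works for all levels, so [K] is cut into finitely many slabs, each
    covered at a cost proportional to its width. *)
Lemma finite_null_slice T t0 (K : set Y) : t0 \in T -> compact K ->
  (forall c, finite_null f (T :\ t0) (K `&` [set y | f t0 y = c])) ->
  finite_null f T K.
Proof.
move=> t0T cK Kslice e e0; have [b Kb] := compact_coords_bounded cK.
(* [e1] is chosen so that the final total [(2 * B + 1) * (2 * e1)] equals [e]. *)
pose B := `|b t0| + 1; pose e1 := e / (2 * (2 * B + 1)).
have KB y : K y -> - B < f t0 y < B.
  move=> /(Kb t0); rewrite -!ltr_norml /B => h.
  by apply: lt_trans h _; rewrite (le_lt_trans (ler_norm _)) // ltrDl.
have B0 : 0 < B by rewrite /B ltr_wpDl.
have e10 : 0 < e1 by rewrite /e1 divr_gt0 //; lra.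
have [d /andP[d0 d1] Kd] : exists2 d, 0 < d <= 1 & forall y, K y ->
    finite_cover f (T :\ t0) (K `&` [set z | `|f t0 y - f t0 z| <= d]) e1.
  move/compact_near_coveringP: (cK) => cK'.
  have : \forall d \near (0:R)^'+, K `<=` [set y |
      finite_cover f (T :\ t0) (K `&` [set z | `|f t0 y - f t0 z| <= d]) e1].
    apply: (cK' _ _ (fun d y =>
      finite_cover f (T :\ t0) (K `&` [set z | `|f t0 y - f t0 z| <= d]) e1)).
    move=> y Ky; have [U [yU Ue]] := finite_cover_nbhs (Kslice (f t0 y) e1 e10).
    (* A cover of the level through [y] also covers a slab around it; half of its width leaves room
       to move [y] to [z]. *)
    have [|d d0 dU] := near_slices (c := f t0 y) (U := U) cK (fc (t := t0)).
      by move=> z Kz zy; apply: yU.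
    near=> z c => /=; apply: finite_coverS _ (lexx _) Ue => w [Kw wc].
    apply: dU => //.
    have h1 : `|f t0 y - f t0 z| < d / 2.
      near: z; apply: (cvgr_dist_lt (f t0) (f t0 y)); [exact: fc|by rewrite divr_gt0].
    have h2 : c < d / 2 by near: c; apply: nbhs_right_lt; rewrite divr_gt0.
    rewrite -(subrK (f t0 z) (f t0 y)) -addrA (le_lt_trans (ler_normD _ _)) //.
    by move: wc => /=; lra.
  move=> H; near (0:R)^'+ => d; exists d; last exact: (near H).
  by apply/andP; split; near: d; [exact: nbhs_right_gt | exact: nbhs_right_le].
(* Half-open slabs of width [d] are added one by one; each sits in an open slab of width [2 * d]. *)
have step k : finite_cover f T (K `&` [set y | f t0 y < - B + k%:R * d])
    (k%:R * (2 * d * e1)).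
  elim: k => [|k IH].
    rewrite !mul0r addr0; apply: finite_coverS _ (lexx 0) (finite_cover0 f T).
    by move=> y [/KB/andP[/lt_trans h _] /h]; rewrite ltxx.
  rewrite -natr1 [_ * (2 * d * e1)]mulrDl mul1r.
  pose u := - B + k%:R * d.
  pose A := K `&` [set y | u <= f t0 y < u + d].
  apply: (@finite_coverS _ _ _ _
    (K `&` [set y | f t0 y < u] `|` A) (k%:R * (2 * d * e1) + 2 * d * e1)) => //.
    move=> y [Ky /= yk]; have [yu|uy] := ltP (f t0 y) u; [by left|right].
    by split => //=; rewrite uy /=; move: yk; rewrite mulrDl mul1r addrA.
  apply: finite_coverU => //.
  have Ae1 : finite_cover f (T :\ t0) A e1.
    have [A0|/set0P[y [Ky yu]]] := eqVneq A set0.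
      by rewrite A0; apply: finite_coverS _ (ltW e10) (finite_cover0 _ _).
    apply: finite_coverS _ (lexx _) (Kd y Ky) => z [Kz zu]; split => //=.
    by move: yu zu => /= /andP[? ?] /andP[? ?]; rewrite ler_norml; apply/andP; split; lra.
  have -> : 2 * d * e1 = (u + d - (u - d)) * e1 by ring.
  apply: (@finite_cover_slab _ f T t0) => //; first by lra.
  by move=> y [_ /= /andP[? ?]]; apply/andP; split; lra.
(* [k] slabs reach [B], and [d <= 1] keeps their total width at most [2 * B + 1]. *)
pose k := (Num.trunc (2 * B / d)).+1.
have kd1 : 2 * B <= k%:R * d by rewrite -ler_pdivrMr // ltW // truncnS_gt.
have kd2 : k%:R * d <= 2 * B + 1.
  rewrite /k -natr1 mulrDl mul1r lerD // -ler_pdivlMr // truncn_le.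
  by rewrite divr_ge0 // ?mulr_ge0 // ltW.
apply: finite_coverS (step k).
  by move=> y Ky; split => //=; have /andP[_] := KB _ Ky; lra.
have -> : k%:R * (2 * d * e1) = (k%:R * d) * (2 * e1) by ring.
apply: (@le_trans _ _ ((2 * B + 1) * (2 * e1))).
  by rewrite ler_wpM2r // mulr_ge0 // ltW.
by rewrite /e1 le_eqVlt; apply/orP; left; apply/eqP; field; lra.
Unshelve. all: by end_near. Qed.

Lemma closed_level t c : closed [set y | f t y = c].
Proof.
have := @preimage_closed _ _ (f t) [set c] (fun y _ => @fc t y).
by apply; exact: closed_eq.
Qed.

(** Iterated Fubini: the coordinates in [U] are fixed one after another. *)
Lemma finite_null_slices T (U : {set D}) (K : set Y) : U \subset T -> compact K ->
  (forall y : D -> R, finite_null f (T :\: U)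
     (K `&` [set x | forall t, t \in U -> f t x = y t])) ->
  finite_null f T K.
Proof.
have [k] := ubnP #|U|; elim: k T U K => // k IH T U K.
have [->|/finset.set0Pn[t0 t0U]] := eqVneq U finset.set0.
  move=> _ _ _ /(_ (fun=> 0)); rewrite finset.setD0.
  by apply: finite_nullS => y Ky; split => // t; rewrite inE.
rewrite (cardsD1 t0) t0U ltnS => Uk UT cK Knull.
apply: (finite_null_slice (t0 := t0)) => // [|c]; first exact: (fintype.subsetP UT).
apply: (IH _ (U :\ t0)) => //.
- exact: finset.setSD.
- by apply: compact_closedI => //; exact: closed_level.
- move=> y.
  have -> : (T :\ t0) :\: (U :\ t0) = T :\: U.
    by apply/finset.setP => t; rewrite !inE; case: eqP => [->|]; rewrite ?t0U ?andbF.
  apply: finite_nullS (Knull (fun t => if t == t0 then c else y t)).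
  move=> x [[Kx xc] xy]; split => // t tU; case: eqP => [->//|/eqP tt0].
  by apply: xy; rewrite !inE tt0.
Qed.

End Fubini.

End FiniteCovers.

(** * Countable unions: from finite covers to Lebesgue null sets *)

Lemma lebesgue_null_bigcup (R : realType) (D : finType) (I : countType)
    (E : I -> set (D -> R)) :
  (forall i, finite_null (fun t x => x t) [set: D]%SET (E i)) ->
  lebesgue_null (\bigcup_i E i).
Proof.
move=> Enull e e0; pose E' k := if unpickle k is Some i then E i else set0.
(* The [k]-th set gets the budget [e / 2 ^ k.+1]; numbers that code no index get the empty set. *)
have /choice[s Es] k : exists s : seq ((D -> R) * (D -> R)),
    (forall y, E' k y -> has (in_part [set: D]%SET ^~ y) s) /\
    \sum_(q <- s) part_vol [set: D]%SET q <= e / (2 ^ k.+1)%:R.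
  have ek0 : 0 < e / (2 ^ k.+1)%:R by rewrite divr_gt0 // ltr0n expn_gt0.
  rewrite /E'; case: unpickle => [i|]; first exact: Enull.
  have [s [_ se]] := @finite_null_set0 R D _ (fun t x => x t) [set: D]%SET _ ek0.
  by exists s.
pose dflt : (D -> R) * (D -> R) := (fun=> 0, fun=> 0).
(* Box number [i] of the [k]-th cover is stored at the code of the pair [(k, i)]. *)
pose P := [set: nat] `*`` (fun k => `I_(size (s k))).
pose q n := if @unpickle (nat * nat)%type n is Some ki
  then nth dflt (s ki.1) ki.2 else dflt.
exists (pickle @` P), (fun n => (q n).1), (fun n => (q n).2); split.
  move=> x [i _ Eix]; have /(Es _).1 : E' (pickle i) x by rewrite /E' pickleK.
  move=> /(has_nthP dflt)[j js /'forall_implyP xj].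
  exists (pickle (pickle i, j)); first by exists (pickle i, j).
  move=> t; rewrite /q pickleK /=.
  by have /andP[/ltW -> /ltW ->] := xj t (finset.in_setT t).
rewrite esum_image; last by move=> i j _ _ /(pcan_inj pickleK).
rewrite (eq_esum (b := fun ki => (part_vol [set: D]%SET (nth dflt (s ki.1) ki.2))%:E)).
  rewrite -(esum_esum (a := fun k i => (part_vol [set: D]%SET (nth dflt (s k) i))%:E)).
    apply: le_trans (epsilon_trick0 xpredT (ltW e0)).
    rewrite nneseries_esumT => [|n]; last by rewrite lee_fin divr_ge0 // ltW.
    apply: le_esum => k _.
    rewrite esum_fset; [|exact: finite_II|by move=> i _; rewrite lee_fin part_vol_ge0].
    rewrite -fsbig_ord sumEFin lee_fin; apply: le_trans (Es k).2.
    by rewrite (big_nth dflt) big_mkord.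
  by move=> k i _ _; rewrite lee_fin part_vol_ge0.
move=> [k i] _; rewrite /q pickleK /box_vol /part_vol /=.
by congr (_%:E); apply: eq_bigl => t; rewrite inE.
Qed.

(** * Dickson's lemma on exponent vectors *)

Lemma nondecreasing_subseq (u : nat -> nat) :
  exists g : nat -> nat, (forall i j, (i < j)%N -> (g i < g j)%N) /\
    forall i j, (i <= j)%N -> (u (g i) <= u (g j))%N.
Proof.
(* Each next index is one where [u] attains its minimum over the remaining tail. *)
have /choice[a aP] N : exists a, (N <= a)%N /\ forall b, (N <= b)%N -> (u a <= u b)%N.
  have ex : exists v, `[< exists2 b, (N <= b)%N & u b = v >].
    by exists (u N); apply/asboolP; exists N.
  have [v /asboolP[b Nb <-] vmin] := ex_minnP ex; exists b; split => // b' Nb'.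
  by apply: vmin; apply/asboolP; exists b'.
pose g := fix g k := if k is k'.+1 then a (g k').+1 else a 0%N.
have gS k : (g k < g k.+1)%N by exact: (aP (g k).+1).1.
have uS k : (u (g k) <= u (g k.+1))%N.
  case: k => [|k] /=; first by apply: (aP _).2.
  by apply: (aP _).2; exact: ltn_trans (gS k) (gS k.+1).
exists g; split; first by apply: (homo_ltn ltn_trans); exact: gS.
by apply: (homo_leq (f := fun k => u (g k)) leqnn leq_trans); exact: uS.
Qed.

(** Subsequences making one more coordinate nondecreasing are extracted in turn; any two terms of
    the last one are comparable. *)
Lemma dickson n (f : nat -> 'I_n -> nat) :
  exists i j, (i < j)%N /\ forall k, (f i k <= f j k)%N.
Proof.
suff /(_ n)[g [gi fg]] : forall m, exists g : nat -> nat,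
    (forall i j, (i < j)%N -> (g i < g j)%N) /\
    forall k : 'I_n, (k < m)%N -> forall i j, (i <= j)%N -> (f (g i) k <= f (g j) k)%N.
  by exists (g 0%N), (g 1%N); split => [|k]; [exact: gi | exact: fg].
elim=> [|m [g [gi fg]]]; first by exists id.
have [mn|nm] := ltnP m n; last first.
  by exists g; split => // k _; apply: fg; exact: leq_trans (ltn_ord k) nm.
have [h [hi fh]] := nondecreasing_subseq (fun i => f (g i) (Ordinal mn)).
exists (g \o h); split => [i j ij|k]; first by apply/gi/hi.
rewrite ltnS leq_eqVlt => /orP[/eqP km|km] i j ij /=.
  by have -> : k = Ordinal mn by [exact: val_inj]; exact: fh.
by apply: fg => //; move: ij; rewrite leq_eqVlt => /orP[/eqP ->//|/hi/ltnW].
Qed.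

(** * Zariski-closed sets, lines and Noetherianity *)

Section Zariski.
Variables (R : realType) (I : finType).
Local Notation space := {ffun I -> R^o}.
Implicit Types (Z X : set space) (p q : mpoly #|I| R).

Definition coord_poly (i : I) : mpoly #|I| R := mpolyX R (mnm1 (enum_rank i)).

Lemma coord_polyE i x : coord_eval (coord_poly i) x = x i.
Proof. by rewrite /coord_eval mevalXU enum_rankK. Qed.

Lemma zariski_closedP Z : zariski_closed Z <->
  forall x, ~ Z x -> exists p, (forall z, Z z -> coord_eval p z = 0) /\ coord_eval p x <> 0.
Proof.
split=> [[F ->] x /existsNP[p /not_implyP[Fp px]]|ZP].
  by exists p; split => // z /(_ p Fp).
exists [set p | forall z, Z z -> coord_eval p z = 0].
apply/seteqP; split=> [z Zz p /(_ z Zz)//|x xF].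
by apply: contrapT => /ZP[p [pZ]]; apply; exact: xF.
Qed.

Lemma zariski_closedI Z1 Z2 :
  zariski_closed Z1 -> zariski_closed Z2 -> zariski_closed (Z1 `&` Z2).
Proof.
move=> /zariski_closedP Z1c /zariski_closedP Z2c; apply/zariski_closedP => x.
move=> /not_andP[/Z1c|/Z2c] [p [pZ px]]; exists p; split => // z [Z1z Z2z]; exact: pZ.
Qed.

Lemma zariski_closed_bigcap (J : Type) (Z : J -> set space) :
  (forall j, zariski_closed (Z j)) -> zariski_closed (\bigcap_j Z j).
Proof.
move=> Zc; apply/zariski_closedP => x /existsNP[j /not_implyP[_ Zjx]].
have /zariski_closedP/(_ x Zjx)[p [pZ px]] := Zc j.
by exists p; split => // z Zz; apply: pZ; exact: Zz.
Qed.

Lemma zariski_closed_level p c : zariski_closed [set x | coord_eval p x = c].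
Proof.
apply/zariski_closedP => x xc; exists (p - mpolyC _ c); rewrite /coord_eval; split.
  by move=> z <-; rewrite mevalB mevalC subrr.
by rewrite mevalB mevalC => /eqP; rewrite subr_eq0 => /eqP.
Qed.

Lemma zariski_closed_coord i c : zariski_closed [set x : space | x i = c].
Proof.
have -> : [set x : space | x i = c] = [set x | coord_eval (coord_poly i) x = c].
  by apply/seteqP; split => x /=; rewrite coord_polyE.
exact: zariski_closed_level.
Qed.

Lemma zariski_closureC Z : zariski_closed (zariski_closure Z).
Proof.
apply/zariski_closedP => x /existsNP[W /not_implyP[[Wc ZW] Wx]].
have /zariski_closedP/(_ x Wx)[p [pW px]] := Wc.
by exists p; split => // z zZ; apply: pW; exact: zZ.
Qed.

Lemma zariski_closed_scale Z (t : R) :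
  zariski_closed Z -> zariski_closed [set x | Z (t *: x)].
Proof.
move=> /zariski_closedP Zc; apply/zariski_closedP => x /Zc[p [pZ px]].
pose lq := [tuple (t *: mpolyX R (mnm1 i)) | i < #|I|].
have E z : coord_eval (comp_mpoly lq p) z = coord_eval p (t *: z).
  rewrite /coord_eval comp_mpoly_meval; apply: meval_eq => i.
  by rewrite tnth_mktuple mevalZ mevalXU ffunE.
by exists (comp_mpoly lq p); split => [z Zz|]; rewrite E //; exact: pZ.
Qed.

Lemma coord_eval_line p (x : space) :
  exists q : {poly R}, forall t, coord_eval p (t *: x) = q.[t].
Proof.
exists (\sum_(m <- msupp p) (mcoeff m p)%:P *
  \prod_(i < #|I|) (x (enum_val i) *: 'X) ^+ m i) => t.
rewrite /coord_eval mevalE horner_sum; apply: eq_bigr => m _.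
rewrite hornerM hornerC horner_prod; congr (_ * _); apply: eq_bigr => i _.
by rewrite horner_exp hornerZ hornerX ffunE [_ *: _]mulrC.
Qed.

(** Otherwise two polynomials, each nonzero somewhere on the line, would have restrictions whose
    product vanishes everywhere and hence is zero. *)
Lemma line_irreducible (x : space) Z1 Z2 :
  zariski_closed Z1 -> zariski_closed Z2 ->
  (forall t : R, Z1 (t *: x) \/ Z2 (t *: x)) ->
  (forall t : R, Z1 (t *: x)) \/ (forall t : R, Z2 (t *: x)).
Proof.
move=> /zariski_closedP Z1c /zariski_closedP Z2c Z12; apply: contrapT.
move=> /not_orP[/existsNP[t1 /Z1c[p1 [p1Z p1x]]] /existsNP[t2 /Z2c[p2 [p2Z p2x]]]].
have [q1 E1] := coord_eval_line p1 x; have [q2 E2] := coord_eval_line p2 x.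
have q12 t : (q1 * q2).[t] = 0.
  rewrite hornerM -E1 -E2.
  by have [/p1Z ->|/p2Z ->] := Z12 t; rewrite ?mul0r ?mulr0.
suff /eqP : q1 * q2 = 0.
  by rewrite mulf_eq0 => /orP[]/eqP q0; [apply: p1x|apply: p2x];
    rewrite ?E1 ?E2 q0 horner0.
apply/eqP/contraT => q0.
(* The naturals below [size (q1 * q2)] would be too many distinct roots. *)
have := max_poly_roots q0 (rs := [seq i%:R | i <- iota 0 (size (q1 * q2))]).
rewrite size_map size_iota ltnn; apply.
  by apply/allP => _ /mapP[i _ ->]; rewrite rootE q12.
by rewrite map_inj_uniq ?iota_uniq //; exact: mulrIn (oner_neq0 _).
Qed.

(** Hilbert's basis theorem by leading monomials: each strict inclusion gives a new polynomial of
    minimal leading monomial, and by Dickson's lemma one of these monomials divides a later one,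
    which can then be reduced. *)
Lemma zariski_closed_dcc (Z : nat -> set space) :
  (forall k, zariski_closed (Z k)) -> ~ (forall k, Z k.+1 `<` Z k).
Proof.
move=> Zc Zlt.
have Zmono i j : (i <= j)%N -> Z j `<=` Z i.
  elim: j => [|j IH]; first by rewrite leqn0 => /eqP ->.
  rewrite leq_eqVlt => /orP[/eqP ->//|/IH]; apply: subset_trans.
  exact: (Zlt j).1.
pose fresh k p := (forall z, Z k.+1 z -> coord_eval p z = 0) /\
  exists2 z, Z k z & coord_eval p z <> 0.
have /choice[p pP] k : exists p, fresh k p /\
    forall q, fresh k q -> ~ (mlead q < mlead p)%O.
  have [p0 fp0] : exists p, fresh k p.
    have /existsNP[z /not_implyP[Zz Z'z]] := (Zlt k).2.
    have /zariski_closedP/(_ z Z'z)[p [pZ pz]] := Zc k.+1.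
    by exists p; split => //; exists z.
  apply: contrapT => nomin.
  suff : forall m q, mlead q = m -> ~ fresh k q by move/(_ _ p0 erefl); apply.
  apply: (well_founded_ind (@ltom_wf #|I|)) => m IH q qm fq; apply: nomin.
  by exists q; split => // q' fq' q'q; apply: IH (erefl _) fq'; rewrite -qm.
have [i [j [ij mij]]] := dickson (fun k => fun_of_multinom (mlead (p k))).
have {}mij : lem (mlead (p i)) (mlead (p j)) by apply/mnm_lepP.
have nz k : p k != 0.
  by apply/eqP => pk0; have [[_ [z _ pz]] _] := pP k; apply: pz; rewrite pk0 /coord_eval meval0.
have lc k : mcoeff (mlead (p k)) (p k) != 0 by rewrite mleadc_eq0.
pose c := mcoeff (mlead (p j)) (p j) / mcoeff (mlead (p i)) (p i).
pose X := mpolyX R (mnm_sub (mlead (p j)) (mlead (p i))).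
have c0 : c != 0 by rewrite mulf_neq0 ?invr_eq0.
have X0 : X != 0 by rewrite /X -msupp_eq0 msuppX.
(* [r] is the multiple of [p i] with the leading term of [p j]; it vanishes on [Z j] because
   [i < j]. *)
pose r := c *: (X * p i).
have rlead : mlead r = mlead (p j) by rewrite mleadZ // mleadM // mleadXm submK.
have rlc : mcoeff (mlead (p j)) r = mcoeff (mlead (p j)) (p j).
  rewrite /r mcoeffZ -{1}(submK mij) -{1}[mnm_sub _ _](@mleadXm _ R) mleadcM.
  by rewrite mleadXm mcoeffX eqxx mul1r divfK.
have rZ z : Z j z -> coord_eval r z = 0.
  move=> Zjz; rewrite /r /coord_eval mevalZ mevalM.
  by rewrite [meval _ (p i)](pP i).1.1 ?mulr0 //; exact: Zmono Zjz.
have [[pj0 [z Zjz pjz]] pjmin] := pP j; apply: (pjmin (p j - r)).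
  split=> [w Zw|]; last first.
    by exists z => //; rewrite /coord_eval mevalB [meval _ r]rZ // subr0.
  rewrite /coord_eval mevalB [meval _ (p j)]pj0 // [meval _ r]rZ ?subr0 //.
  exact: Zmono Zw.
rewrite lt_neqAle; apply/andP; split; last first.
  by apply: le_trans (mleadB_le _ _) _; rewrite rlead joinxx.
(* Equal leading monomials would force [p j = r], which vanishes at [z]. *)
apply/eqP => E; have : mcoeff (mlead (p j)) (p j - r) = 0 by rewrite mcoeffB rlc subrr.
rewrite -E => /eqP; rewrite mleadc_eq0 => /eqP pjr; apply: pjz.
have := rZ z Zjz; rewrite /coord_eval.
by rewrite -[p j](subrK r) pjr add0r.
Qed.

(** Without a minimum, repeated choice would build an infinite strictly descending sequence. *)
Lemma zariski_closed_min (P : set space -> Prop) Z : zariski_closed Z -> P Z ->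
  exists W, [/\ zariski_closed W, P W, W `<=` Z &
    forall V, zariski_closed V -> P V -> V `<=` W -> V = W].
Proof.
move=> Zc PZ; apply: contrapT => nomin.
pose good W := [/\ zariski_closed W, P W & W `<=` Z].
have next (W : {W | good W}) : exists V : {W | good W}, sval V `<` sval W.
  case: W => W [Wc PW WZ] /=; apply: contrapT => nV; apply: nomin; exists W; split => //.
  move=> V Vc PV VW; apply: contrapT => VneW; apply: nV.
  have gV : good V by split => //; exact: subset_trans VW WZ.
  by exists (exist _ V gV); split => // WV; apply: VneW; exact/seteqP.
have [g gP] := choice next.
have gZ : good Z by split.
apply: (@zariski_closed_dcc (fun k => sval (iter k g (exist _ Z gZ)))).
  by move=> k; case: (iter _ _ _) => W [].
by move=> k; exact: gP.
Qed.

Lemma irreducible_chain_snoc X W d : zariski_closed X -> irreducible X ->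
  W `<=` X -> ~ (X `<=` W) -> irreducible_chain W d -> irreducible_chain X d.+1.
Proof.
move=> Xc Xirr WX XW [C [CP Clt]].
exists (fun i => if (i <= d)%N then C i else X); split=> i id.
  case: ifP => [/CP[? ? CW]|_]; split => //; exact: subset_trans CW WX.
move: id; rewrite ltnS => id; rewrite id; case: ltnP => [/Clt//|di].
have [_ _ CW] := CP i id; split; first exact: subset_trans CW WX.
by move=> /subset_trans /(_ CW).
Qed.

Lemma irreducible_chainS X W d :
  W `<=` X -> irreducible_chain W d -> irreducible_chain X d.
Proof.
move=> WX [C [CP Clt]]; exists C; split => // i /CP[? ? CW]; split => //.
exact: subset_trans CW WX.
Qed.

End Zariski.

(** * Compactness and continuity in the product topology *)

Section ProductTopology.
Variables (R : realType) (I : finType).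
Local Notation prod_space := (prod_topology (fun _ : I => R : topologicalType)).

Lemma continuous_coord (i : I) : continuous (fun y : prod_space => y i).
Proof. exact: (@proj_continuous I (fun=> R : topologicalType)). Qed.

Lemma compact_cube (b : R) : compact [set y : prod_space | forall i, `|y i| <= b].
Proof.
have -> : [set y : prod_space | forall i, `|y i| <= b] =
    [set y | forall i, `[- b, b]%classic (y i)].
  by apply/seteqP; split => y yb i; have := yb i; rewrite /= in_itv /= ler_norml.
apply: (@tychonoff I (fun=> R : topologicalType) (fun=> `[- b, b]%classic)) => i.
exact: segment_compact.
Qed.

Lemma continuous_coord_eval (p : mpoly #|I| R) (Y : topologicalType) (z : Y -> I -> R) :
  (forall i, continuous (z ^~ i)) ->
  continuous (fun y => coord_eval p [ffun i => z y i] : R).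
Proof.
move=> zc y.
have -> : (fun y => coord_eval p [ffun i => z y i] : R) = (fun y =>
    \sum_(m <- msupp p) mcoeff m p * \prod_(i < #|I|) z y (enum_val i) ^+ m i).
  apply/funext => w; rewrite /coord_eval mevalE; apply: eq_bigr => m _.
  by congr (_ * _); apply: eq_bigr => i _; rewrite ffunE.
apply: (@cvg_big R _ +%R) => [x|m _].
  by apply: cvgD; [exact: cvg_fst | exact: cvg_snd].
apply: cvgM; first exact: cvg_cst.
apply: (@cvg_big R _ *%R) => [x|i _].
  by apply: cvgM; [exact: cvg_fst | exact: cvg_snd].
apply: (@continuous_comp _ _ _ (z ^~ (enum_val i)) (fun u : R => u ^+ m i)).
  exact: zc.
exact: exprn_continuous.
Qed.

Lemma closed_zariski_closed (Z : set {ffun I -> R^o}) (Y : topologicalType) (z : Y -> I -> R) :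
  (forall i, continuous (z ^~ i)) ->
  zariski_closed Z -> closed [set y | Z [ffun i => z y i]].
Proof.
move=> zc [F ->].
have -> : [set y | forall p, F p -> coord_eval p [ffun i => z y i] = 0] =
    \bigcap_(p in F) [set y | coord_eval p [ffun i => z y i] = 0].
  by [].
apply: closed_bigI => p _.
apply: (@preimage_closed _ _ (fun y => coord_eval p [ffun i => z y i] : R) [set 0]).
  by move=> y _; exact: continuous_coord_eval.
exact: closed_eq.
Qed.

End ProductTopology.

(** * Chains from non-null polynomial images *)

Section PolynomialImages.
Variables (R : realType) (I D : finType) (f : D -> {ffun I -> R^o} -> R).
Hypothesis fpoly : forall t, exists p, forall x, f t x = coord_eval p x.
Local Notation space := {ffun I -> R^o}.

Definition cube (b : R) : set space := [set x | forall i, `|x i| <= b].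

(** A Zariski-closed set cut by a cube is compact in the product topology, so Fubini for compact
    sets applies. *)
Lemma finite_null_zariski_slice (X : set space) (b : R) (U : {set D}) t0 :
  zariski_closed X -> t0 \in U ->
  (forall c, finite_null f (U :\ t0) (X `&` [set x | f t0 x = c] `&` cube b)) ->
  finite_null f U (X `&` cube b).
Proof.
move=> Xc t0U Xslice.
pose Y : topologicalType := prod_topology (fun _ : I => R : topologicalType).
pose z (y : Y) : space := [ffun i => y i].
pose K : set Y := [set y | X (z y)] `&` [set y | forall i, `|y i| <= b].
have zK x : (X `&` cube b) x -> K (x : I -> R).
  by move=> [Xx xb]; split => //=; congr (X _): Xx; apply/ffunP => i; rewrite ffunE.
have cK : compact K.
  rewrite /K setIC; apply: compact_closedI; first exact: compact_cube.
  by apply: closed_zariski_closed => //; exact: continuous_coord.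
suff Knull : finite_null (fun t y => f t (z y)) U K.
  move=> e /Knull; apply: finite_cover_transfer => x /zK Kx.
  exists (x : I -> R) => // t _; congr (f t _).
  by apply/ffunP => i; rewrite ffunE.
apply: (@finite_null_slice R D Y (fun t y => f t (z y)) _ U t0) => //.
  move=> t; have [p fp] := fpoly t.
  have -> : (fun y : Y => f t (z y)) = (fun y => coord_eval p [ffun i => y i]).
    by apply/funext => y; rewrite fp.
  by apply: continuous_coord_eval; exact: continuous_coord.
move=> c e /(Xslice c); apply: finite_cover_transfer => y [[Xy yb] yc].
by exists (z y) => //; split => // i; rewrite ffunE.
Qed.

Lemma polynomial_image_bounded (b : R) : exists B : D -> R, forall t x,
  cube b x -> - B t < f t x < B t.
Proof.
pose Y : topologicalType := prod_topology (fun _ : I => R : topologicalType).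
pose z (y : Y) : space := [ffun i => y i].
have fc t : continuous (fun y : Y => f t (z y)).
  have [p fp] := fpoly t.
  have -> : (fun y : Y => f t (z y)) = (fun y => coord_eval p [ffun i => y i]).
    by apply/funext => y; rewrite fp.
  by apply: continuous_coord_eval; exact: continuous_coord.
have [B fB] := compact_coords_bounded fc (@compact_cube R I b).
exists B => t x xb; have := fB t (x : I -> R) xb.
by have -> : z (x : I -> R) = x by apply/ffunP => i; rewrite ffunE.
Qed.

(* A Zariski-closed set minimal among those with non-null image is irreducible,
   and by Fubini one of its hyperplane sections still has a non-null image. *)
Lemma irreducible_chain_image (X : set space) (b : R) (U : {set D}) :
  zariski_closed X -> ~ finite_null f U (X `&` cube b) ->
  irreducible_chain X #|U|.
Proof.
have [n] := ubnP #|U|; elim: n U X => // n IH U X Un Xc Xnull.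
have [Z [Zc Znull ZX Zmin]] := zariski_closed_min
  (P := fun Z => ~ finite_null f U (Z `&` cube b)) Xc Xnull.
apply: irreducible_chainS ZX _.
have Zirr : irreducible Z.
  split.
    apply/set0P/eqP => Z0; apply: Znull; rewrite Z0 set0I; exact: finite_null_set0.
  move=> Z1 Z2 Z1c Z2c Z12.
  (* By minimality, a closed [V] whose intersection with [Z] has non-null image contains [Z]; two
     proper parts covering [Z] would thus both be null. *)
  suff part V : zariski_closed V -> ~ finite_null f U (Z `&` V `&` cube b) -> Z `<=` V.
    apply: contrapT => /not_orP[nZ1 nZ2]; apply: Znull.
    apply: (@finite_nullS _ _ _ _ _ _
      ((Z `&` Z1 `&` cube b) `|` (Z `&` Z2 `&` cube b))).
      by move=> x [Zx xb]; have [Z1x|Z2x] := Z12 x Zx; [left|right].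
    by apply: finite_nullU; apply: contrapT; [move/(part _ Z1c)|move/(part _ Z2c)].
  move=> Vc /Zmin <-; [exact: subIsetr|exact: zariski_closedI|exact: subIsetl].
have [U0|/finset.set0Pn[t0 t0U]] := eqVneq U finset.set0.
  by rewrite U0 finset.cards0; exists (fun=> Z); split => [i _|//]; split.
have [p fp] := fpoly t0.
have levelc c : zariski_closed [set x | f t0 x = c].
  have -> : f t0 = coord_eval p by apply/funext.
  exact: zariski_closed_level.
have [c Zslice] : exists c,
    ~ finite_null f (U :\ t0) (Z `&` [set x | f t0 x = c] `&` cube b).
  apply: contrapT => nZ; apply: Znull.
  apply: (@finite_null_zariski_slice _ _ _ t0) => // c; apply: contrapT => nc.
  by apply: nZ; exists c.
rewrite (cardsD1 t0) t0U add1n.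
apply: (irreducible_chain_snoc (W := Z `&` [set x | f t0 x = c])) => //.
(* If [Z] lay in the level set, its image would lie in a hyperplane and be null. *)
- have [B fB] := polynomial_image_bounded b.
  move=> Zc'; apply: Znull.
  apply: (finite_null_hyperplane (b := B) (c := c) t0U) => [t x [_ xb]|x [Zx _]].
    exact: fB.
  by have [] := Zc' x Zx.
- apply: IH => //; last exact: zariski_closedI.
  by move: Un; rewrite (cardsD1 t0) t0U add1n ltnS.
Qed.

End PolynomialImages.

(** * Cones and joins *)

Section Cones.
Variables (R : realType) (I : finType).
Local Notation space := {ffun I -> R^o}.

(* The Zariski closure of the cone over an irreducible set inside [x i0 = 1] is
   irreducible and leaves this hyperplane. *)
Lemma irreducible_chain_cone (C : set space) (i0 : I) d :
  zariski_closed C -> (forall (t : R) x, C x -> C (t *: x)) ->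
  irreducible_chain (C `&` [set x | x i0 = 1]) d -> irreducible_chain C d.+1.
Proof.
move=> Cc Ccone [Z [ZP Zlt]].
have [_ [[x0 Zx0] Zirr] ZC] := ZP d (leqnn d).
pose N : set space := [set x | exists z (t : R), Z d z /\ x = t *: z].
pose W := zariski_closure N.
have NW : N `<=` W by exact: sub_smallest.
have WC : W `<=` C.
  by apply: smallest_sub => // _ [z [t [/ZC[Cz _] ->]]]; exact: Ccone.
apply: irreducible_chainS WC _.
apply: (irreducible_chain_snoc (W := Z d)).
- exact: zariski_closureC.
- split; first by exists x0; apply: NW; exists x0, 1; rewrite scale1r.
  move=> Z1 Z2 Z1c Z2c W12.
  (* [A V] collects the points all of whose multiples lie in [V]; irreducibility of [Z d] is applied
     to these sets. *)
  pose A V : set space := \bigcap_(t in [set: R]) [set x | V (t *: x)].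
  have Ac V : zariski_closed V -> zariski_closed (A V).
    by move=> Vc; apply: zariski_closed_bigcap => t; exact: zariski_closed_scale.
  have AW V : zariski_closed V -> Z d `<=` A V -> W `<=` V.
    move=> Vc ZA; apply: smallest_sub => // _ [z [t [/ZA Az ->]]]; exact: Az.
  have [] := Zirr (A Z1) (A Z2) (Ac _ Z1c) (Ac _ Z2c).
  + move=> z Zz; have [|Az|Az] := line_irreducible (x := z) Z1c Z2c.
    * by move=> t; apply: W12; apply: NW; exists z, t.
    * by left=> t _; exact: Az.
    * by right=> t _; exact: Az.
  + by move=> /(AW _ Z1c); left.
  + by move=> /(AW _ Z2c); right.
- by move=> z Zz; apply: NW; exists z, 1; rewrite scale1r.
- have [_ x01] := ZC _ Zx0.
  (* Doubling [x0] leaves the hyperplane, so [W] is strictly larger than [Z d]. *)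
  have N2x0 : N (2 *: x0) by exists x0, 2.
  move=> WZ; have [_ /=] := ZC _ (WZ _ (NW _ N2x0)).
  rewrite ffunE x01 => E; suff : 2 * 1 = 1 :> R by lra.
  exact: E.
(* The chain ends at [Z d], so each of its members lies in [Z d]. *)
- exists Z; split => // i id; have [? ? _] := ZP i id; split => //.
  have [k dE] : exists k, d = (k + i)%N by exists (d - i)%N; rewrite subnK.
  move: Zlt; rewrite dE => {dE}; elim: k => [_ //|k IHk]; rewrite addSn => Zlt.
  apply: (@subset_trans _ (Z (k + i)%N)); last exact: (Zlt _ _).1.
  by apply: IHk => j jk; apply: Zlt; rewrite ltnS ltnW.
Qed.

(** The generators are stable under scaling, and preimages of closed sets under scaling are
    closed. *)
Lemma join_variety_scale (Y Z : set space) (t : R) x :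
  join_variety Y Z x -> join_variety Y Z (t *: x).
Proof.
move=> Jx; apply: (Jx [set x | join_variety Y Z (t *: x)]); split.
  by apply: zariski_closed_scale; exact: zariski_closureC.
move=> _ [y [z [s [u [Yy Zz ->]]]]]; apply: sub_gen_smallest.
by exists y, z, (t * s), (t * u); split => //; rewrite scalerDr !scalerA.
Qed.

End Cones.

Lemma lebesgue_nullS (R : realType) (D : finType) (E F : set (D -> R)) :
  E `<=` F -> lebesgue_null F -> lebesgue_null E.
Proof.
move=> EF Fnull e /Fnull[Q [a [b [Fc Fe]]]]; exists Q, a, b; split => //.
exact: subset_trans EF Fc.
Qed.

Lemma continuous_sub_sum (R : realType) (T : topologicalType) (J : finType)
    (a : T -> R) (b c : J -> T -> R) :
  continuous a -> (forall j, continuous (b j)) -> (forall j, continuous (c j)) ->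
  continuous (fun y => a y - \sum_j b j y * c j y).
Proof.
move=> ac bc cc y; apply: cvgB; first exact: ac.
apply: (@cvg_big R _ +%R) => [x|j _].
  by apply: cvgD; [exact: cvg_fst | exact: cvg_snd].
by apply: cvgM; [exact: bc | exact: cc].
Qed.

(** * Subspaces in a chart that meet a cone *)

Section ConesMeetingSubspaces.
Variables (R : realType) (I : finType) (J : {set I}).
Local Notation space := {ffun I -> R^o}.
Implicit Types (X : chart_idx J -> R) (x : space).

(** The graph equations are linear in [x], so they only need checking on the spanning vectors. *)
Lemma mem_chart X x : x \in chart X ->
  forall i : {i : I | i \notin J},
    x (val i) = \sum_(j : {j : I | j \in J}) x (val j) * X (j, i) :> R.
Proof.
move=> xX i; rewrite /chart in xX.
have -> := coord_span (X := in_tuple [seq chart_vec X j | j : {j : I | j \in J}]) xX.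
pose P x := x (val i) = \sum_(j : {j : I | j \in J}) x (val j) * X (j, i) :> R.
apply: (big_ind P); rewrite /P.
- by rewrite ffunE big1 // => j _; rewrite ffunE mul0r.
- move=> y z yP zP; rewrite ffunE [LHS](congr2 +%R yP zP) -big_split /=.
  by apply: eq_bigr => j _; rewrite ffunE [RHS]mulrDl.
move=> k _; rewrite ffunE; set v := _`_k; set a := coord _ _ _.
suff vE : P v.
  rewrite [LHS](congr1 ( *%R a) vE) mulr_sumr; apply: eq_bigr => j _.
  by rewrite ffunE mulrA.
rewrite /P; have /mapP[j _ ->] : v \in [seq chart_vec X j | j : {j : I | j \in J}] by exact: mem_nth.
have vecE k' : chart_vec X j k' =
    (k' == val j)%:R + \sum_(i' : {i : I | i \notin J}) X (j, i') * (k' == val i')%:R :> R.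
  rewrite /chart_vec ffunE [basis_vec _ _ _]ffunE sum_ffunE; congr (_ + _).
  by apply: eq_bigr => i' _; rewrite !ffunE.
have disj (j' : {j : I | j \in J}) (i' : {i : I | i \notin J}) : (val j' == val i') = false.
  by apply/eqP => E; have := valP i'; rewrite -E (valP j').
have vecJ (j' : {j : I | j \in J}) : chart_vec X j (val j') = (j' == j)%:R :> R.
  by rewrite vecE big1 ?addr0 // => i' _; rewrite disj mulr0.
have -> : chart_vec X j (val i) = X (j, i) :> R.
  rewrite vecE eq_sym disj add0r (bigD1 i) //= eqxx mulr1 big1 ?addr0 // => i' i'i.
  by rewrite val_eqE eq_sym (negbTE i'i) mulr0.
rewrite (bigD1 j) //= vecJ eqxx mul1r big1 ?addr0 // => j' j'j.
by rewrite vecJ (negbTE j'j) mul0r.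
Qed.

Lemma finite_null_meet_cone (C : set space) (j0 : {j : I | j \in J}) (b : R) :
  zariski_closed C -> (forall (t : R) x, C x -> C (t *: x)) ->
  ~ irreducible_chain C #|{: {i : I | i \notin J}}|.+1 ->
  finite_null (fun t (X : chart_idx J -> R) => X t) [set: chart_idx J]%SET
    [set X | (forall t, `|X t| <= b) /\ exists x,
      [/\ C x, cube b x, x (val j0) = 1 & forall i : {i : I | i \notin J},
        x (val i) = \sum_(j : {j : I | j \in J}) x (val j) * X (j, i) :> R]].
Proof.
move=> Cc Ccone Cdim.
(* Points of [Y] are pairs of a vector and a chart matrix, so the existential over [x] becomes a
   projection. *)
pose Y : topologicalType :=
  prod_topology (fun _ : (I + chart_idx J)%type => R : topologicalType).
pose z (y : Y) : space := [ffun i => y (inl i)].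
pose eqn (i : {i : I | i \notin J}) (y : Y) : R :=
  y (inl (val i)) - \sum_(j : {j : I | j \in J}) y (inl (val j)) * y (inr (j, i)).
pose K : set Y := [set y | forall k, `|y k| <= b] `&`
  ([set y | C (z y)] `&` [set y | y (inl (val j0)) = 1] `&`
   \bigcap_i [set y | eqn i y = 0]).
have yc k : continuous (fun y : Y => y k) by exact: continuous_coord.
have eqnc i : continuous (eqn i).
  exact: (continuous_sub_sum (a := fun y : Y => y (inl (val i)))
    (b := fun j (y : Y) => y (inl (val j))) (c := fun j (y : Y) => y (inr (j, i)))).
have cK : compact K.
  apply: compact_closedI; first exact: compact_cube.
  apply: closedI; first apply: closedI.
  - by apply: closed_zariski_closed => // i; exact: yc.
  - apply: (@preimage_closed _ _ (fun y : Y => y (inl (val j0))) [set 1]); last exact: closed_eq.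
    by move=> y _; exact: yc.
  - apply: closed_bigI => i _; apply: (@preimage_closed _ _ (eqn i) [set 0]); last exact: closed_eq.
    by move=> y _; exact: eqnc.
suff Knull : finite_null (fun t (y : Y) => y (inr t)) [set: chart_idx J]%SET K.
  move=> e /Knull; apply: finite_cover_transfer => X [Xb [x [Cx xb x1 xX]]].
  exists (fun k => match k with inl i => x i | inr t => X t end) => //; split => /=.
    by case.
  split; first split => //=.
    by congr (C _): Cx; apply/ffunP => i; rewrite ffunE.
  by move=> i _; rewrite /eqn /= xX subrr.
(* Slicing along [U] fixes all rows of the matrix except row [j0]. *)
pose U : {set chart_idx J} := [set t | t.1 != j0]%SET.
apply: (@finite_null_slices R _ Y _ _ _ U)  => // y0.
(* Since [x (val j0) = 1], the graph equation at [i] gives the entry [(j0, i)] as this affine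
   function of [x]. *)
pose g (t : chart_idx J) (x : space) : R :=
  x (val t.2) - \sum_(j | j != j0) x (val j) * y0 (j, t.2).
have gpoly t : exists p, forall x, g t x = coord_eval p x.
  exists (coord_poly R (val t.2) - \sum_(j | j != j0) y0 (j, t.2) *: coord_poly R (val j)) => x.
  rewrite /coord_eval mevalB (raddf_sum (meval _)) /=; apply: (congr2 (fun u v : R => u - v)).
    by rewrite [RHS]coord_polyE.
  by apply: eq_bigr => j _; rewrite mevalZ [meval _ _]coord_polyE mulrC.
pose H : set space := C `&` [set x | x (val j0) = 1].
have Hc : zariski_closed H.
  by apply: zariski_closedI => //; exact: zariski_closed_coord.
suff Hnull : finite_null g ([set: chart_idx J] :\: U)%SET (H `&` cube b).
  move=> e /Hnull; apply: finite_cover_transfer.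
  move=> y [[yb [[Cz z1] yeqn]] yU]; exists (z y).
    split; last by move=> i; rewrite ffunE.
    by split => //=; rewrite ffunE.
  move=> [j i]; rewrite !inE andbT negbK => /= /eqP ->.
  have /eqP := yeqn i Logic.I; rewrite /eqn subr_eq0 /g /= => /eqP.
  rewrite ffunE => ->; rewrite (bigD1 j0) //= z1 mul1r -[LHS]addr0 -addrA.
  congr (_ + _); apply/esym/eqP; rewrite subr_eq0; apply/eqP.
  by apply: eq_bigr => j' j'j0; rewrite ffunE -(yU (j', i)) // inE.
apply: contrapT => /(irreducible_chain_image gpoly Hc).
(* Row [j0] has one entry for each index outside [J]; the cone then lengthens the chain by one. *)
have -> : #|([set: chart_idx J] :\: U)%SET| = #|{: {i : I | i \notin J}}|.
  have -> : ([set: chart_idx J] :\: U)%SET = finset.setX [set j0]%SET finset.setT.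
    by apply/finset.setP => t; rewrite !inE negbK !andbT.
  by rewrite finset.cardsX finset.cards1 mul1n finset.cardsT.
by move=> /(irreducible_chain_cone Cc Ccone).
Qed.

Lemma zariski_dim_chain (C : set space) r : (zariski_dim C <= (r%:R)%:E)%E ->
  ~ irreducible_chain C r.+1.
Proof.
move=> Cr Cchain; have : ((r.+1%:R : R)%:E <= (r%:R)%:E)%E.
  by apply: le_trans Cr; apply: ereal_sup_ubound; exists r.+1.
by rewrite lee_fin ler_nat ltnn.
Qed.

(** The bad set is a countable union over the cone, the pivot coordinate and an integer bound. *)
Lemma lebesgue_null_meet_cones (L : countType) (C : L -> set space) r :
  (forall l, zariski_closed (C l)) ->
  (forall l (t : R) x, C l x -> C l (t *: x)) ->
  (forall l, (zariski_dim (C l) <= (r%:R)%:E)%E) -> #|J| = (#|I| - r)%N ->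
  lebesgue_null [set X : chart_idx J -> R |
    exists l x, [/\ C l x, x != 0 & x \in chart X]].
Proof.
move=> Cc Ccone Cdim Jr.
pose E (k : L * ({j : I | j \in J} * nat)) : set (chart_idx J -> R) :=
  [set X | (forall t, `|X t| <= k.2.2%:R) /\ exists x,
      [/\ C k.1 x, cube k.2.2%:R x, x (val k.2.1) = 1 & forall i : {i : I | i \notin J},
        x (val i) = \sum_(j : {j : I | j \in J}) x (val j) * X (j, i) :> R]].
apply: (@lebesgue_nullS _ _ _ (\bigcup_k E k)); last first.
  apply: lebesgue_null_bigcup => -[l [j0 b]]; apply: finite_null_meet_cone.
  - exact: Cc.
  - exact: Ccone.
  (* The pivot [j0] makes [J] nonempty, so [r < #|I|] and the truncated subtraction is exact. *)
  have -> : #|{: {i : I | i \notin J}}| = r.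
    rewrite card_sig -[RHS](@subKn r #|I|) -?Jr; last first.
      have : (0 < #|J|)%N by apply/card_gt0P; exists (val j0); exact: valP.
      by rewrite Jr subn_gt0 => /ltnW.
    by rewrite -(cardC J) addKn; apply: eq_card.
  exact: zariski_dim_chain (Cdim l).
move=> X [l [x [Cx x0 /mem_chart xX]]].
(* A vector of the graph that vanishes on [J] is zero, so a pivot exists. *)
have [j0 xj0] : exists j : {j : I | j \in J}, x (val j) != 0.
  apply/existsP/contraT => /existsPn xJ; case/eqP: x0; apply/ffunP => i; rewrite [RHS]ffunE.
  have xJ0 (j : {j : I | j \in J}) : x (val j) = 0 by apply/eqP; have := xJ j; rewrite negbK.
  have [iJ|iJ] := boolP (i \in J); first exact: (xJ0 (exist _ i iJ)).
  by rewrite (xX (exist _ i iJ)) big1 // => j _; rewrite xJ0 mul0r.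
pose y : space := (x (val j0))^-1 *: x.
pose B := \sum_i `|y i| + \sum_t `|X t|.
pose b := (Num.trunc B).+1.
have Bb : B <= b%:R by exact/ltW/truncnS_gt.
exists (l, (j0, b)) => //; split => [t|].
  apply: le_trans Bb; rewrite /= /B (bigD1 t) //= addrCA lerDl.
  by rewrite addr_ge0 // sumr_ge0.
exists y; split => [|i||i] /=.
- exact: Ccone.
- apply: le_trans Bb; rewrite /= /B (bigD1 i) //= -addrA lerDl.
  by rewrite addr_ge0 // sumr_ge0.
- by rewrite ffunE; exact: mulVf.
- rewrite ffunE [LHS](congr1 ( *%R (x (val j0))^-1) (xX i)) mulr_sumr.
  by apply: eq_bigr => j _; rewrite ffunE mulrA.
Qed.

End ConesMeetingSubspaces.

(** * Rank-one tensors determine their factors up to scaling *)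

Section RankOneTensors.
Variables (R : realType) (K S : nat).

(* If [g (i k) k != 0] for all k, the ratios [h (i k) k / g (i k) k] are the
   scaling factors: changing one index of the entry [i] isolates one column. *)
Lemma tensor_prod_inj (h g : 'M[R]_(S, K)) :
  tensor_prod h = tensor_prod g -> params_star g -> scale_class g h.
Proof.
move=> hg gstar.
have /choice[i gi] k : exists i, g i k != 0.
  apply/existsP/contraT => /existsPn gk; case/negP: (gstar k); apply/eqP/colP => i.
  by rewrite !mxE; apply/eqP; have := gk i; rewrite negbK.
have prodE (j : 'I_K -> 'I_S) : \prod_k h (j k) k = \prod_k g (j k) k.
  have /ffunP/(_ (finfun j)) := hg; rewrite !ffunE => E.
  transitivity (\prod_k h (finfun j k) k); last rewrite E;
    by apply: eq_bigr => k _; rewrite ffunE.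
have prod0 : \prod_k g (i k) k != 0 by apply/prodf_neq0 => k _; exact: gi.
have hi k : h (i k) k != 0.
  by apply/eqP => hk0; move: prod0; rewrite -prodE (bigD1 k) //= hk0 mul0r eqxx.
pose lam k := h (i k) k / g (i k) k.
have hlam l k : h l k = lam k * g l k.
  have := prodE (fun k' => if k' == k then l else i k').
  rewrite (bigD1 k) //= [RHS](bigD1 k) //= !eqxx.
  rewrite (eq_bigr (fun k' => h (i k') k')) => [|k' /negbTE -> //].
  rewrite [in RHS](eq_bigr (fun k' => g (i k') k')) => [|k' /negbTE -> //].
  have := prodE i; rewrite (bigD1 k) //= [RHS](bigD1 k) //=.
  set a := \prod_(_ | _) _; set c := \prod_(_ | _) _ => ac lac.
  have a0 : a != 0 by apply/prodf_neq0 => k' _; exact: hi.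
  have -> : h l k = g l k * c / a by rewrite -lac mulfK.
  have -> : c = h (i k) k * a / g (i k) k by rewrite ac mulrAC divff ?gi // mul1r.
  by rewrite /lam; field; rewrite a0 gi.
split.
  move=> k; apply/eqP => /colP/(_ (i k)); rewrite !mxE => hk0.
  by have := hi k; rewrite hk0 eqxx.
exists lam; split.
  rewrite big_split /= prodfV prodE divff //.
by move=> k; apply/colP => l; rewrite !mxE.
Qed.

End RankOneTensors.

(** * Bad kernels and identifiability *)

Theorem theorem6p4 (R : realType) (K S m n : nat)
    (hK : (1 <= K)%N) (hS : (2 <= S)%N) (hm : (1 <= m)%N) (hn : (1 <= n)%N)
    (M : nat -> set 'M[R]_(S, K)) (hM : forall L, M L !=set0)
    (r : nat)
    (hr : forall L L' : nat,
       (zariski_dim (join_variety (@tensor_prod R K S @` M L)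
                     (@tensor_prod R K S @` M L'))
          <= (r%:R)%:E)%E) :
  exists E : set {vspace {ffun tensor_idx K S -> R^o}},
    grassmann_null (S ^ K - r) E /\
    forall A : 'Hom({ffun tensor_idx K S -> R^o}, 'M[R]_(m, n)),
      \dim (limg A) = r -> ~ E (lker A) -> identifiable_model A M.
Proof.
pose C L L' := join_variety (@tensor_prod R K S @` M L) (@tensor_prod R K S @` M L').
have cardI : #|tensor_idx K S| = (S ^ K)%N by rewrite card_ffun !card_ord.
exists [set V | \dim V = (S ^ K - r)%N /\
  exists L L' x, [/\ C L L' x, x != 0 & x \in V]]; split.
  split=> [V []//|J Jr].
  apply: lebesgue_nullS (lebesgue_null_meet_cones (r := r)
    (C := fun k : nat * nat => C k.1 k.2) _ _ _ _).
  - by move=> X [_ [L [L' xX]]]; exists (L, L').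
  - by move=> k; exact: zariski_closureC.
  - by move=> k t x; exact: join_variety_scale.
  - by move=> k; exact: hr.
  - by rewrite cardI.
move=> A rkA AE L hbar ML hstar L' h [ML' hmin].
apply: tensor_prod_inj hstar.
(* [hbar] competes with residual 0, so the minimizer [h] has residual 0 too. *)
have Ah : A (tensor_prod h) = A (tensor_prod hbar).
  have := hmin L hbar ML; rewrite subrr.
  have -> : sqnorm (0 : 'M[R]_(m, n)) = 0.
    by rewrite /sqnorm big1 // => i _; rewrite big1 // => j _; rewrite mxE expr0n.
  move=> le0; apply/eqP; rewrite -subr_eq0; apply/eqP/matrixP => i j; rewrite [RHS]mxE.
  set D := A _ - A _ in le0 *.
  apply/eqP; rewrite -sqrf_eq0 eq_le sqr_ge0 andbT; apply: le_trans le0.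
  rewrite /sqnorm (bigD1 i) //= (bigD1 j) //= -addrA lerDl addr_ge0 //.
    by apply: sumr_ge0 => *; exact: sqr_ge0.
  by apply: sumr_ge0 => ? _; apply: sumr_ge0 => *; exact: sqr_ge0.
apply: contrapT => hne; apply: AE; split.
  have := limg_ker_dim A fullv; rewrite capfv dimvf /dim /= muln1 cardI rkA => <-.
  by rewrite addnK.
exists L', L, (tensor_prod h - tensor_prod hbar); split.
(* The coefficients 1 and -1 put the difference in the join. *)
- apply: sub_gen_smallest; exists (tensor_prod h), (tensor_prod hbar), 1, (-1).
  by split; [exists h | exists hbar | rewrite scale1r scaleN1r].
- by rewrite subr_eq0; apply/eqP.
- by rewrite memv_ker linearB /= Ah subrr.
Qed.
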